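(* There exist positive vectors $\boldsymbol{u}\in\mathbb{R}_{>0}^m$, $\boldsymbol{v}\in\mathbb{R}_{>0}^n$ with $\|\boldsymbol{u}\|_1=\|\boldsymbol{v}\|_1=1$, feasible $\gamma,\gamma'$ with $\gamma+\gamma'>1$, and a $(\gamma,\gamma')$-dense, $(\boldsymbol{u},\boldsymbol{v})$-scalable matrix $A$ such that, with input $(A,(\boldsymbol{u},\boldsymbol{v}))$, SK takes $\Omega(\log n-\log\varepsilon)$ iterations to output a matrix $B$ satisfying $\|\boldsymbol{r}(B)-\boldsymbol{u}\|_1+\|\boldsymbol{c}(B)-\boldsymbol{v}\|_1\le\varepsilon$.
   Context: The asymptotic bound is understood for a family of such instances with the dimension growing and $\varepsilon$ small, with an absolute constant: the smallest $k$ for which the SK iterate $A^{(k)}$ satisfies the error bound is at least $c(\log n-\log\varepsilon)$. Row/column sums $r_i,c_j$ and vectors $\boldsymbol{r},\boldsymbol{c}$ as usual. SK on input $(A,(\boldsymbol{u},\boldsymbol{v}))$: $A^{(0)}_{ij}=u_iA_{ij}/r_i(A)$; odd $k$: $A^{(k)}_{ij}=v_jA^{(k-1)}_{ij}/c_j(A^{(k-1)})$; even $k\ge2$: $A^{(k)}_{ij}=u_iA^{(k-1)}_{ij}/r_i(A^{(k-1)})$. $A$ is $(\boldsymbol{u},\boldsymbol{v})$-scalable if there exist positive diagonal $X,Y$ with $XAY$ having row sums $\boldsymbol{u}$ and column sums $\boldsymbol{v}$. For nonzero $A\ge0$ with $t=\max A_{ij}$: $A$ is $(\gamma,\gamma',\rho)$-dense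 w.r.t. $(\boldsymbol{u},\boldsymbol{v})$ if $\gamma=\min_i\sum_k v_k\mathbf{1}[A_{ik}>\rho t]/\|\boldsymbol{v}\|_1$ and $\gamma'=\min_j\sum_k u_k\mathbf{1}[A_{kj}>\rho t]/\|\boldsymbol{u}\|_1$; $A$ is $(\gamma,\gamma')$-dense if it is $(\gamma,\gamma',\rho)$-dense for some $\rho\in(0,1]$. A pair $(\gamma,\gamma')\in(0,1]^2$ is feasible (for $\boldsymbol{u},\boldsymbol{v}$) if some matrix is $(\gamma,\gamma')$-dense with respect to $(\boldsymbol{u},\boldsymbol{v})$. *)

(* Defs.v *)
From mathcomp Require Import all_boot all_order all_algebra.
From mathcomp Require Import reals.

Set Implicit Arguments.
Unset Strict Implicit.
Unset Printing Implicit Defensive.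

Import Order.TTheory GRing.Theory Num.Theory.
Local Open Scope ring_scope.

Section Vectors.
Variable R : realType.

Definition norm1 n (x : 'rV[R]_n) : R := \sum_(j < n) `|x 0 j|.

Definition positive_vec n (x : 'rV[R]_n) : Prop := forall j, 0 < x 0 j.

Definition row_sums m n (A : 'M[R]_(m, n)) : 'rV[R]_m :=
  \row_i \sum_(j < n) A i j.

Definition col_sums m n (A : 'M[R]_(m, n)) : 'rV[R]_n :=
  \row_j \sum_(i < m) A i j.

Definition nonneg_mx m n (A : 'M[R]_(m, n)) : Prop := forall i j, 0 <= A i j.

(* [a] is the minimum of [f]; in particular the index type is nonempty. *)
Definition is_min (I : finType) (f : I -> R) (a : R) : Prop :=
  (exists i, f i = a) /\ (forall i, a <= f i).

End Vectors.

Section SinkhornKnopp.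
Variables (R : realType) (m n : nat).
Implicit Types (A : 'M[R]_(m, n)) (u : 'rV[R]_m) (v : 'rV[R]_n).

Definition row_normalize u A : 'M[R]_(m, n) :=
  \matrix_(i, j) (u 0 i * A i j / row_sums A 0 i).

Definition col_normalize v A : 'M[R]_(m, n) :=
  \matrix_(i, j) (v 0 j * A i j / col_sums A 0 j).

Fixpoint SK A u v (k : nat) : 'M[R]_(m, n) :=
  match k with
  | 0 => row_normalize u A
  | k'.+1 => if odd k then col_normalize v (SK A u v k')
             else row_normalize u (SK A u v k')
  end.

Definition scaling_error u v (B : 'M[R]_(m, n)) : R :=
  norm1 (row_sums B - u) + norm1 (col_sums B - v).

(* [k] is the smallest index whose SK iterate has error at most [eps]. *)
Definition SK_iterations A u v (eps : R) (k : nat) : Prop :=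
  scaling_error u v (SK A u v k) <= eps /\
  (forall j, (j < k)%N -> eps < scaling_error u v (SK A u v j)).

Definition mx_scalable A u v : Prop :=
  exists (x : 'rV[R]_m) (y : 'rV[R]_n),
    [/\ positive_vec x, positive_vec y,
        row_sums (diag_mx x *m A *m diag_mx y) = u &
        col_sums (diag_mx x *m A *m diag_mx y) = v].

(* Starting the maximum at 0 is harmless: it is only used for A >= 0. *)
Definition max_entry A : R :=
  \big[Num.max/0]_(i < m) \big[Num.max/0]_(j < n) A i j.

Definition mx_dense3 u v (g g' rho : R) A : Prop :=
  [/\ nonneg_mx A, A != 0,
      is_min (fun i : 'I_m =>
        (\sum_(k < n | rho * max_entry A < A i k) v 0 k) / norm1 v) g &
      is_min (fun j : 'I_n =>
        (\sum_(k < m | rho * max_entry A < A k j) u 0 k) / norm1 u) g'].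

Definition mx_dense u v (g g' : R) A : Prop :=
  exists2 rho : R, 0 < rho <= 1 & mx_dense3 u v g g' rho A.

Definition feasible_pair u v (g g' : R) : Prop :=
  [/\ 0 < g <= 1, 0 < g' <= 1 & exists A : 'M[R]_(m, n), mx_dense u v g g' A].

End SinkhornKnopp.

(* Main.v *)
Require Import Defs.
From mathcomp Require Import all_boot all_order all_algebra.
From mathcomp Require Import reals exp.
From mathcomp Require Import ring lra zify.

Import Order.TTheory GRing.Theory Num.Theory.
Local Open Scope ring_scope.

(** Take m = 2, u = (1/2, 1/2), v = (2/3, 1/(3p), ..., 1/(3p)) with n = p + 1,
    and let A have first row (1, 0, ..., 0) and second row all ones.  Every SK
    iterate has the same shape, and the even ones are determined by the ratio w
    of the mass of the second row outside the first column to its entry in the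
    first column.  One column step followed by one row step maps w to 1 + w/2,
    so w = 2 + 2^-k (p - 2) at index 2k, while the error at indices 2k and
    2k + 1 is (w - 2) / (3 (1 + w)) and (w - 2) / (3 (2 + w)).  Hence the error
    stays of constant order for about log n steps and then decays at a constant
    exponential rate. *)

Ltac pos := repeat first
  [ assumption | exact: ltr01 | exact: ltr0Sn | apply: divr_gt0
  | apply: mulr_gt0 | apply: addr_gt0 | apply: exprn_gt0 ].
Ltac nonzero := repeat (apply/andP; split); rewrite gt_eqF //; pos.

(** * Hook-shaped matrices: marginals and normalizations *)

Section HookMatrix.
Variables (R : realType) (p : nat).
Hypothesis p_gt0 : (0 < p)%N.

Definition hook_mx (a b c : R) : 'M[R]_(2, p.+1) :=
  \matrix_(i, j) if i == ord0 then (if j == ord0 then a else 0)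
                 else (if j == ord0 then b else c).

Definition hook_u : 'rV[R]_2 := const_mx (1 / 2).

Definition hook_v : 'rV[R]_p.+1 :=
  \row_j if j == ord0 then 2 / 3 else 1 / 3 / p%:R.

Let pR_gt0 : 0 < p%:R :> R. Proof. by rewrite ltr0n. Qed.

Let pR_neq0 : p%:R != 0 :> R. Proof. by rewrite gt_eqF. Qed.

Lemma sum_head_const (x y : R) :
  \sum_(j < p.+1) (if j == ord0 then x else y) = x + p%:R * y.
Proof.
rewrite big_ord_recl eqxx; congr (_ + _).
by rewrite (eq_bigr (fun=> y)) // sumr_const card_ord mulr_natl.
Qed.

Lemma row_sums_hook a b c i :
  row_sums (hook_mx a b c) 0 i = if i == ord0 then a else b + p%:R * c.
Proof.
rewrite mxE; case: (altP (i =P ord0)) => [->|i0].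
  under eq_bigr => j _ do rewrite mxE eqxx.
  by rewrite sum_head_const mulr0 addr0.
under eq_bigr => j _ do rewrite mxE (negPf i0).
exact: sum_head_const.
Qed.

Lemma col_sums_hook a b c j :
  col_sums (hook_mx a b c) 0 j = if j == ord0 then a + b else c.
Proof.
by rewrite mxE !big_ord_recl big_ord0 !mxE /= addr0; case: ifP; rewrite ?add0r.
Qed.

Lemma row_normalize_hook a b c : a != 0 ->
  row_normalize hook_u (hook_mx a b c) =
  hook_mx (1 / 2) (1 / 2 * b / (b + p%:R * c)) (1 / 2 * c / (b + p%:R * c)).
Proof.
move=> a0; apply/matrixP=> i j; rewrite mxE row_sums_hook !mxE.
by case: ifP => _; case: ifP => _ //; rewrite ?mulr0 ?mul0r // mulfK.
Qed.

Lemma col_normalize_hook a b c : c != 0 ->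
  col_normalize hook_v (hook_mx a b c) =
  hook_mx (2 / 3 * a / (a + b)) (2 / 3 * b / (a + b)) (1 / 3 / p%:R).
Proof.
move=> c0; apply/matrixP=> i j; rewrite mxE col_sums_hook !mxE.
by case: ifP => _; case: ifP => _ //; rewrite ?mulr0 ?mul0r // mulfK.
Qed.

Lemma norm1_hook_u : norm1 hook_u = 1.
Proof.
rewrite /norm1 !big_ord_recl big_ord0 !mxE ger0_norm ?divr_ge0 //; lra.
Qed.

Lemma hook_u_gt0 : positive_vec hook_u.
Proof. by move=> i; rewrite mxE; lra. Qed.

Lemma hook_v_gt0 : positive_vec hook_v.
Proof.
move=> j; rewrite mxE; case: ifP => _; first lra.
by rewrite !divr_gt0.
Qed.

Lemma norm1_hook_v : norm1 hook_v = 1.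
Proof.
rewrite /norm1; under eq_bigr => j _ do rewrite gtr0_norm ?hook_v_gt0 // mxE.
by rewrite sum_head_const; field.
Qed.

(** * Closed form of the SK iterates *)

Definition hook_even (w : R) :=
  hook_mx (1 / 2) (1 / 2 / (1 + w)) (1 / 2 * (w / p%:R) / (1 + w)).

Definition hook_odd (w : R) :=
  hook_mx (2 / 3 * (1 + w) / (2 + w)) (2 / 3 / (2 + w)) (1 / 3 / p%:R).

Lemma col_normalize_hook_even w : 0 < w ->
  col_normalize hook_v (hook_even w) = hook_odd w.
Proof.
move=> w0; rewrite col_normalize_hook; last first.
  by nonzero.
by congr hook_mx; field; nonzero.
Qed.

Lemma row_normalize_hook_odd w : 0 < w ->
  row_normalize hook_u (hook_odd w) = hook_even (1 + w / 2).
Proof.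
move=> w0; rewrite row_normalize_hook; last first.
  by nonzero.
by congr hook_mx; field; nonzero.
Qed.

(** Distance of w from 2, the fixed point of w -> 1 + w/2. Each round halves it; it starts at p - 2
    because an all-ones second row has w = p. *)
Definition hook_gap (k : nat) : R := (p%:R - 2) / 2 ^+ k.

Lemma SK_hook k : (2 < p)%N ->
  let w := 2 + hook_gap k in
  SK (hook_mx 1 1 1) hook_u hook_v k.*2 = hook_even w /\
  SK (hook_mx 1 1 1) hook_u hook_v k.*2.+1 = hook_odd w.
Proof.
move=> p2 w.
have gap_gt0 l : 0 < hook_gap l.
  by rewrite divr_gt0 ?exprn_gt0 // subr_gt0 ltr_nat.
suff Ek : SK (hook_mx 1 1 1) hook_u hook_v k.*2 = hook_even w.
  split=> //; rewrite /= odd_double /= Ek col_normalize_hook_even //.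
  by rewrite addr_gt0.
rewrite {}/w; elim: k => [|k IH].
  rewrite /= row_normalize_hook ?oner_eq0 // /hook_gap expr0 divr1.
  have -> : 2 + (p%:R - 2) = p%:R :> R by rewrite addrC subrK.
  by congr hook_mx; field; nonzero.
rewrite doubleS /= odd_double /= IH.
rewrite col_normalize_hook_even ?addr_gt0 // row_normalize_hook_odd ?addr_gt0 //.
congr hook_even; rewrite /hook_gap exprS; field.
by nonzero.
Qed.

(** * Error of the iterates *)

Lemma scaling_error_hook a b c :
  scaling_error hook_u hook_v (hook_mx a b c) =
  `|a - 1 / 2| + `|b + p%:R * c - 1 / 2|
  + (`|a + b - 2 / 3| + p%:R * `|c - 1 / 3 / p%:R|).
Proof.
rewrite /scaling_error /norm1 !big_ord_recl big_ord0 addr0.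
congr (_ + _ + (_ + _)).
- by rewrite mxE row_sums_hook !mxE.
- by rewrite mxE row_sums_hook !mxE.
- by rewrite mxE col_sums_hook !mxE.
rewrite (eq_bigr (fun=> `|c - 1 / 3 / p%:R|)) ?sumr_const ?card_ord ?mulr_natl //.
by move=> j _; rewrite mxE col_sums_hook !mxE.
Qed.

(** The rows are exact and the total mass is 1, so the deficit of the first column equals the total
    excess of the others: each side gives half of the error. *)
Lemma scaling_error_hook_even d : 0 < d ->
  scaling_error hook_u hook_v (hook_even (2 + d)) = d / (3 * (3 + d)).
Proof.
move=> d0; have d3 : 0 < 3 + d by lra.
rewrite scaling_error_hook.
have e_ge0 : 0 <= d / (3 * (3 + d)) / 2 by rewrite !divr_ge0 ?mulr_ge0 ?ltW.
have -> : 1 / 2 - 1 / 2 = 0 :> R by rewrite subrr.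
have -> : 1 / 2 / (1 + (2 + d)) + p%:R * (1 / 2 * ((2 + d) / p%:R) / (1 + (2 + d)))
          - 1 / 2 = 0 by field; nonzero.
have -> : 1 / 2 + 1 / 2 / (1 + (2 + d)) - 2 / 3 = - (d / (3 * (3 + d)) / 2).
  by field; nonzero.
(* Moving p inside the absolute value merges the p equal column deviations into one. *)
rewrite -{1}(gtr0_norm pR_gt0) -normrM.
have -> : p%:R * (1 / 2 * ((2 + d) / p%:R) / (1 + (2 + d)) - 1 / 3 / p%:R)
          = d / (3 * (3 + d)) / 2.
  by field; nonzero.
by rewrite normr0 normrN !ger0_norm //; lra.
Qed.

(** Now the columns are exact, and the excess of the first row balances the deficit of the
    second. *)
Lemma scaling_error_hook_odd d : 0 < d ->
  scaling_error hook_u hook_v (hook_odd (2 + d)) = d / (3 * (4 + d)).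
Proof.
move=> d0; have d4 : 0 < 4 + d by lra.
rewrite scaling_error_hook.
have e_ge0 : 0 <= d / (3 * (4 + d)) / 2 by rewrite !divr_ge0 ?mulr_ge0 ?ltW.
have -> : 2 / 3 * (1 + (2 + d)) / (2 + (2 + d)) - 1 / 2 = d / (3 * (4 + d)) / 2.
  by field; nonzero.
have -> : 2 / 3 / (2 + (2 + d)) + p%:R * (1 / 3 / p%:R) - 1 / 2
          = - (d / (3 * (4 + d)) / 2).
  by field; nonzero.
have -> : 2 / 3 * (1 + (2 + d)) / (2 + (2 + d)) + 2 / 3 / (2 + (2 + d)) - 2 / 3 = 0.
  by field; nonzero.
by rewrite subrr normr0 normrN !ger0_norm //; lra.
Qed.

(** The odd error is the smaller of the two, so it bounds both parities from below. The crude upper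
    bound only serves to show that the error tends to 0. *)
Lemma SK_hook_error_bounds j : (2 < p)%N ->
  hook_gap j./2 / (3 * (4 + hook_gap j./2))
    <= scaling_error hook_u hook_v (SK (hook_mx 1 1 1) hook_u hook_v j)
    <= hook_gap j./2.
Proof.
move=> p2; set d := hook_gap _.
have d0 : 0 < d by rewrite divr_gt0 ?exprn_gt0 // subr_gt0 ltr_nat.
have [] := SK_hook j./2 p2; rewrite -/d => Ee Eo.
have ub x : 3 <= x -> d / (3 * x) <= d.
  move=> x3; rewrite ler_pdivrMr; last by lra.
  by rewrite ler_peMr ?ltW //; lra.
rewrite -[X in SK _ _ _ X]odd_double_half; case: (odd j); rewrite ?add1n ?add0n.
  by rewrite Eo scaling_error_hook_odd // lexx ub //; lra.
rewrite Ee scaling_error_hook_even // ub; last by lra.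
by rewrite andbT ler_pM2l // lef_pV2 ?posrE; lra.
Qed.

(** * Density and scalability *)

Lemma max_entry_hook : max_entry (hook_mx 1 1 1) = 1.
Proof.
apply/le_anti/andP; split.
  apply: bigmax_le => // i _; apply: bigmax_le => // j _.
  by rewrite mxE; do 2?case: ifP.
apply: le_trans (le_bigmax _ _ ord0).
by apply: le_trans (le_bigmax _ _ ord0); rewrite mxE.
Qed.

(** The threshold 1/2 separates the entries 0 and 1. The sparsest row is the first, supported on the
    column of weight 2/3; every column but the first is supported on a single row of weight 1/2. *)
Lemma hook_dense : mx_dense hook_u hook_v (2 / 3) (1 / 2) (hook_mx 1 1 1).
Proof.
exists (1 / 2); first by lra.
have thr i j : (1 / 2 * max_entry (hook_mx 1 1 1) < hook_mx 1 1 1 i j)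
               = (i != ord0) || (j == ord0).
  by rewrite max_entry_hook mxE; case: ifP => _; case: ifP => _ /=; lra.
split.
- by move=> i j; rewrite mxE; do 2?case: ifP.
- apply/negP => /eqP/matrixP/(_ ord0 ord0); rewrite !mxE /= => /eqP.
  by rewrite oner_eq0.
- have row0 : (\sum_(k < p.+1 | 1 / 2 * max_entry (hook_mx 1 1 1) < hook_mx 1 1 1 ord0 k)
                 hook_v 0 k) / norm1 hook_v = 2 / 3.
    rewrite norm1_hook_v divr1; under eq_bigl => k do rewrite thr eqxx.
    by rewrite big_pred1_eq mxE.
  split; first by exists ord0.
  move=> i; rewrite -[leLHS]row0 ler_pM2r ?norm1_hook_v ?invr1 //.
  rewrite [leLHS]big_mkcond [leRHS]big_mkcond ler_sum // => k _; rewrite !thr /=.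
  have := hook_v_gt0 k; case: (k == ord0); rewrite ?orbT //= orbF.
  by case: ifP => // _ /ltW.
- have col1 : (\sum_(k < 2 | 1 / 2 * max_entry (hook_mx 1 1 1) < hook_mx 1 1 1 k ord_max)
                 hook_u 0 k) / norm1 hook_u = 1 / 2.
    rewrite norm1_hook_u divr1 big_mkcond !big_ord_recl big_ord0 !thr /= !mxE.
    by rewrite -val_eqE /= eqn0Ngt p_gt0 add0r addr0.
  split; first by exists ord_max.
  move=> j; rewrite -[leLHS]col1 ler_pM2r ?norm1_hook_u ?invr1 //.
  rewrite [leLHS]big_mkcond [leRHS]big_mkcond ler_sum // => k _; rewrite !thr /=.
  have -> : (ord_max == ord0 :> 'I_p.+1) = false.
    by rewrite -val_eqE /= eqn0Ngt p_gt0.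
  have := hook_u_gt0 k; case: (k == ord0) => //=.
  by case: ifP => // _ /ltW.
Qed.

Lemma hook_scalable : mx_scalable (hook_mx 1 1 1) hook_u hook_v.
Proof.
(* The marginals force the entries 1/2, 1/6 and 1/(3p), which is [hook_even] at w = 2; setting the
   first entry of [y] to 1 determines the rest. *)
pose x : 'rV[R]_2 := \row_i if i == ord0 then 1 / 2 else 1 / 6.
pose y : 'rV[R]_p.+1 := \row_j if j == ord0 then 1 else 2 / p%:R.
have E : diag_mx x *m hook_mx 1 1 1 *m diag_mx y = hook_mx (1 / 2) (1 / 6) (1 / 3 / p%:R).
  rewrite mul_diag_mx mul_mx_diag; apply/matrixP=> i j; rewrite !mxE.
  by case: ifP => _; case: ifP => _; field.
exists x, y; rewrite E; split.
- by move=> i; rewrite mxE; case: ifP => _; lra.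
- by move=> j; rewrite mxE; case: ifP => _ //; rewrite divr_gt0.
- by apply/rowP => i; rewrite row_sums_hook mxE; case: ifP => _ //; field.
- by apply/rowP => j; rewrite col_sums_hook mxE; case: ifP => _ //; field.
Qed.

End HookMatrix.

(** * Counting iterations *)

Lemma natr_le_expr2 (R : realType) k : k%:R <= 2 ^+ k :> R.
Proof. by rewrite -natrX ler_nat ltnW // ltn_expl. Qed.

Lemma ln_pow2_le (R : realType) k : ln (2 ^+ k) <= k%:R :> R.
Proof.
rewrite lnXn // ler_wMn2r //.
by have := @le_ln1Dx R 1; rewrite -[1 + 1]/2; apply; lra.
Qed.

Lemma SK_hook_iterations (R : realType) (p : nat) (eps : R) :
  (8 <= p)%N -> 0 < eps < 1 / 6 ->
  exists k : nat,
    SK_iterations (hook_mx R p 1 1 1) (hook_u R) (hook_v R p) eps k /\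
    1 / 7 * (ln p.+1%:R - ln eps) <= k%:R.
Proof.
move=> p8 /andP[eps0 eps6].
have p0 : (0 < p)%N by lia.
have p2 : (2 < p)%N by lia.
have p8R : 8 <= p%:R :> R by rewrite (ler_nat _ 8).
pose err k := scaling_error (hook_u R) (hook_v R p)
                (SK (hook_mx R p 1 1 1) (hook_u R) (hook_v R p) k).
have [k0 k0P] : exists k, err k <= eps.
  (* Since 2^N >= N > p/eps, the gap at index 2N is at most eps. *)
  pose N := Num.bound (p%:R / eps); exists N.*2.
  have /andP[_ /le_trans] := @SK_hook_error_bounds R p p0 N.*2 p2; apply.
  rewrite doubleK /hook_gap ler_pdivrMr ?exprn_gt0 //.
  have : p%:R / eps < N%:R by apply: archi_boundP; apply: divr_ge0; rewrite ?ler0n ?ltW.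
  rewrite ltr_pdivrMr // => /ltW pN.
  have : N%:R * eps <= 2 ^+ N * eps by rewrite ler_pM2r // natr_le_expr2.
  lra.
case: (ex_minnP (ex_intro (fun k => err k <= eps) k0 k0P)) => k kP kmin.
exists k; split.
  split=> // j jk; rewrite ltNge; apply/negP => /kmin; lia.
have /andP[+ _] := @SK_hook_error_bounds R p p0 k p2.
move=> /le_trans/(_ kP); set d := hook_gap _ _ _.
have d0 : 0 < d by rewrite divr_gt0 ?exprn_gt0 // subr_gt0 ltr_nat.
rewrite ler_pdivrMr; last by lra.
(* From d <= 12 eps + 3 eps d, the bound eps < 1/6 absorbs the last term into d/2. *)
move=> dle; have d6 : eps * d <= 1 / 6 * d by rewrite ler_pM2r // ltW.
have {}dle : d <= 24 * eps by lra.
move: dle; rewrite /d /hook_gap; set q := k./2.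
rewrite ler_pdivrMr ?exprn_gt0 // => dle.
(* Uses p + 1 <= 2 (p - 2), valid as p >= 8. *)
have nle : p.+1%:R <= 48 * eps * 2 ^+ q by rewrite -natr1; lra.
(* If q = 0, then p - 2 <= 24 eps < 4, against p >= 8. *)
have q1 : (1 <= q)%N.
  by rewrite lt0n; apply/eqP => q0; move: dle; rewrite q0 expr0; lra.
(* As q >= 1, 48 <= 2^6 <= 2^(6q); this is the source of the constant 1/7. *)
have {}nle : p.+1%:R / eps <= 2 ^+ (7 * q).
  rewrite ler_pdivrMr //; apply: le_trans nle _.
  rewrite mulrAC ler_pM2r //.
  have -> : (7 * q = q + 6 * q)%N by lia.
  rewrite exprD mulrC ler_pM2l ?exprn_gt0 //.
  rewrite exprM; apply: le_trans (_ : 2 ^+ 6 <= _); first by lra.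
  by apply: ler_eXnr => //; lra.
have qk : q%:R <= k%:R :> R.
  rewrite ler_nat /q; lia.
have : ln (p.+1%:R / eps) <= (7 * q)%:R.
  apply: le_trans (ln_pow2_le R _).
  by rewrite ler_ln ?posrE ?exprn_gt0 ?divr_gt0.
rewrite ln_div ?posrE // natrM; lra.
Qed.

Theorem theorem1p5 (R : realType) :
  exists (c eps0 : R) (n0 : nat),
    [/\ 0 < c, 0 < eps0 &
    forall n : nat, (n0 <= n)%N ->
    exists (m : nat) (u : 'rV[R]_m) (v : 'rV[R]_n) (g g' : R)
           (A : 'M[R]_(m, n)),
      [/\ positive_vec u /\ positive_vec v,
          norm1 u = 1 /\ norm1 v = 1,
          feasible_pair u v g g' /\ 1 < g + g',
          mx_dense u v g g' A /\ mx_scalable A u v &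
          forall eps : R, 0 < eps < eps0 ->
          exists k : nat,
            SK_iterations A u v eps k /\ c * (ln n%:R - ln eps) <= k%:R]].
Proof.
(* The dimension is n = p + 1, so p >= 8 becomes n >= 9. *)
exists (1 / 7), (1 / 6), 9%N; split; [lra | lra |].
case=> // p p8; have p0 : (0 < p)%N by lia.
have dns := @hook_dense R p p0.
exists 2%N, (hook_u R), (hook_v R p), (2 / 3), (1 / 2), (hook_mx R p 1 1 1).
split.
- by split; [apply: hook_u_gt0 | apply: hook_v_gt0].
- by split; [apply: norm1_hook_u | apply: norm1_hook_v].
- split; last by lra.
  by split; [lra | lra | exists (hook_mx R p 1 1 1)].
- by split=> //; apply: hook_scalable.
- by move=> eps; apply: SK_hook_iterations.
Qed.
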